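(* Let $G$ be an $n$-dimensional Lie group with Lie algebra $\mathfrak g=\mathrm{span}\{e_1,\dots,e_n\}$, and suppose that $\mathfrak g=\mathfrak r\oplus\mathfrak s$, where $\mathfrak r=\mathrm{span}\{e_1,\dots,e_m\}$ and $\mathfrak s=\mathrm{span}\{e_{m+1},\dots,e_n\}$, with $$[\mathfrak s,\mathfrak s]\subseteq\mathfrak s,\qquad[\mathfrak s,\mathfrak r]\subseteq\mathfrak r,\qquad[\mathfrak r,\mathfrak r]\subseteq\mathfrak s.$$ Let $g_i$, $u_i$, $\lambda_i$, $C_i$, $\mathbf V_{ij}$, $\mathcal N_i$ ($i=1,\dots,r$) be as in the context, in particular $u_i(t)\in\mathfrak r$ and $\lambda_i(t)\in\mathfrak s^*=\mathrm{span}\{e^{m+1},\dots,e^n\}$. Then, for each $i=1,\dots,r$, the equation $$0=\frac{d}{dt}\left(\frac{\partial C_i}{\partial u_i}+\lambda_i\right)-\mathrm{ad}^*_{u_i}\left(\frac{\partial C_i}{\partial u_i}+\lambda_i\right)-\sum_{j\in\mathcal N_i}T^*_{\bar e_i}L_{g_i}\left(\frac{\partial\mathbf V_{ij}}{\partial g_i}\right)$$ can be rewritten as (is equivalent to) the pair of equations $$\frac{d}{dt}\frac{\partial C_i}{\partial u_i}=\mathrm{ad}^*_{u_i}\lambda_i\Big|_{\mathfrak r}+\sum_{j\in\mathcal N_i}T^*_{\bar e_i}L_{g_i}\left(\frac{\partial\mathbf V_{ij}}{\partial g_i}\right)\Big|_{\mathfrak r},$$ $$\dot\lambda_i=\mathrm{ad}^*_{u_i}\frac{\partial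 C_i}{\partial u_i}\Big|_{\mathfrak s}+\sum_{j\in\mathcal N_i}T^*_{\bar e_i}L_{g_i}\left(\frac{\partial\mathbf V_{ij}}{\partial g_i}\right)\Big|_{\mathfrak s}.$$
   Context: Notation. $\bar e_i$ is the identity of the $i$-th copy of $G$; $L_g(h)=gh$; $T^*_{\bar e}L_g:T^*_gG\to\mathfrak g^*$ denotes the dual of the tangent map $T_{\bar e}L_g:\mathfrak g\to T_gG$. $\mathrm{ad}^*_\xi:\mathfrak g^*\to\mathfrak g^*$ is defined by $\langle\mathrm{ad}^*_\xi\mu,\eta\rangle=\langle\mu,[\xi,\eta]\rangle$. $\{e^1,\dots,e^n\}$ is the basis of $\mathfrak g^*$ dual to $\{e_1,\dots,e_n\}$; thus $\mathfrak g^*=\mathfrak r^*\oplus\mathfrak s^*$ with $\mathfrak r^*=\mathrm{span}\{e^1,\dots,e^m\}$ and $\mathfrak s^*=\mathrm{span}\{e^{m+1},\dots,e^n\}$. For $\alpha\in\mathfrak g^*$, $\alpha|_{\mathfrak r}$ and $\alpha|_{\mathfrak s}$ denote the components of $\alpha$ in $\mathfrak r^*$ and $\mathfrak s^*$ with respect to this decomposition. Setting. There are $r$ agents $i\in\mathcal N=\{1,\dots,r\}$ connected by a static, connected, undirected graph $(\mathcal N,\mathcal E)$, with $\mathcal N_i=\{j\in\mathcal N:(i,j)\in\mathcal E\}$. The curves $g_i\in C^1([0,T],G)$ satisfy $\dot g_i=T_{\bar e_i}L_{g_i}(u_i)$ with controls $u_i(t)=\sum_{k=1}^mu_i^k(t)e_k\in\mathfrak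 r$. The multipliers are $\lambda_i\in C^1([0,T],\mathfrak g^* )$ of the form $\lambda_i=\sum_{k=m+1}^n\lambda_i^ke^k$. The cost function $C_i$ of agent $i$ is smooth and left-invariant ($C_i(hg_i,u_i)=C_i(g_i,u_i)$ for all $h\in G$), so it depends only on $u_i$; it is a function of the controls $u_i^1,\dots,u_i^m$, so $\frac{\partial C_i}{\partial u_i}\in\mathfrak r^*$, and $t\mapsto\frac{\partial C_i}{\partial u_i}(u_i(t))$ is assumed differentiable so that the equations make sense. $V_{ij}:G\times G\to\mathbb R$ are smooth potentials, $\mathbf V_{ij}:G\to\mathbb R$ is given by $\mathbf V_{ij}(g_i^{-1}g_j)=V_{ij}(\bar e_i,g_i^{-1}g_j)$, and $\frac{\partial\mathbf V_{ij}}{\partial g_i}\in T^*_{g_i}G$ is the partial derivative with respect to $g_i$ of $(g_i,g_j)\mapsto\mathbf V_{ij}(g_i^{-1}g_j)$. *)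

(* Defs.v *)
From HB Require Import structures.
From mathcomp Require Import all_boot all_order all_algebra.
From mathcomp Require Import all_classical all_reals all_analysis.

Set Implicit Arguments.
Unset Strict Implicit.
Unset Printing Implicit Defensive.

Import Order.TTheory GRing.Theory Num.Theory.
Import numFieldNormedType.Exports.

Local Open Scope classical_set_scope.
Local Open Scope ring_scope.

(* Meant for U open and V finite-dimensional; f is then C^(k+1) on U iff it is
   differentiable on U with all its directional derivatives C^k. *)

Fixpoint Ck_on (R : realType) (V W : normedModType R) (k : nat)
    (U : set V) (f : V -> W) : Prop :=
  match k with
  | 0 => forall x, U x -> {for x, continuous f}
  | k'.+1 => (forall x, U x -> differentiable f x) /\
             (forall v : V, Ck_on k' U (fun x => 'D_v f x))
  end.

Definition smooth_on (R : realType) (V W : normedModType R)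
    (U : set V) (f : V -> W) : Prop :=
  forall k, Ck_on k U f.

(* Smooth manifolds are given by an atlas indexed by the points of the
   manifold: [chart_at x] is the preferred chart around [x].  Every smooth atlas
   can be put in this form by choosing a chart around each point. *)

Record chart (R : realType) (n : nat) (M : topologicalType) := Chart {
  chart_dom : set M;
  chart_fun :> M -> 'rV[R]_n;
  chart_inv : 'rV[R]_n -> M;
  chart_open_dom : open chart_dom;
  chart_open_img : open (chart_fun @` chart_dom);
  chart_funK : forall x, chart_dom x -> chart_inv (chart_fun x) = x;
  chart_fun_continuous : {within chart_dom, continuous chart_fun};
  chart_inv_continuous :
    {within chart_fun @` chart_dom, continuous chart_inv}
}.

HB.mixin Record isSmoothManifold (R : realType) (n : nat) M
    of Topological M := {
  chart_at : M -> chart R n M;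
  chart_at_dom : forall x, chart_dom (chart_at x) x;
  chart_at_compatible : forall x y,
    smooth_on (chart_at x @` (chart_dom (chart_at x) `&`
                              chart_dom (chart_at y)))
              (chart_at y \o chart_inv (chart_at x));
  manifold_hausdorff : hausdorff_space M;
  manifold_second_countable : @second_countable M
}.

#[short(type="smoothManifoldType")]
HB.structure Definition SmoothManifold (R : realType) (n : nat) :=
  {M of isSmoothManifold R n M & Topological M}.

Section Manifolds.
Context {R : realType} {n : nat} {M : smoothManifoldType R n}.

(* M * M and M * V carry the product charts. *)

Definition smooth_mfd (W : normedModType R) (A : set M) (f : M -> W) : Prop :=
  forall p : M,
    smooth_on (chart_at p @` (chart_dom (chart_at p) `&` A))
              (f \o chart_inv (chart_at p)).

Definition smooth_mfd2 (W : normedModType R) (A : set (M * M))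
    (f : M -> M -> W) : Prop :=
  forall p q : M,
    smooth_on
      ((fun z : M * M => (chart_at p z.1, chart_at q z.2)) @`
         ((chart_dom (chart_at p) `*` chart_dom (chart_at q)) `&` A))
      (fun z : 'rV[R]_n * 'rV[R]_n =>
         f (chart_inv (chart_at p) z.1) (chart_inv (chart_at q) z.2)).

Definition smooth_mfd_vec (V W : normedModType R) (f : M -> V -> W) : Prop :=
  forall p : M,
    smooth_on ((chart_at p @` chart_dom (chart_at p)) `*` [set: V])
      (fun z : 'rV[R]_n * V => f (chart_inv (chart_at p) z.1) z.2).

(* T_x M, a tangent vector being represented by its coordinates in the
   preferred chart at x. *)
Definition tangent (x : M) : Type := 'rV[R]_n.

HB.instance Definition _ (x : M) := Vector.copy (tangent x) 'rV[R]_n.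

Definition cotangent (x : M) := 'Hom(tangent x, R^o).

Definition mdiff (f : M -> R) (x : M) : cotangent x :=
  linfun ('d (f \o chart_inv (chart_at x) : 'rV[R]_n -> R^o) (chart_at x x)).

Definition tangent_map (f : M -> M) (x : M) : 'Hom(tangent x, tangent (f x)) :=
  linfun ('d (chart_at (f x) \o f \o chart_inv (chart_at x)) (chart_at x x)).

(* Coordinates of a vector field in the chart p: at the point with
   coordinates y, the image of the field under the differential of p. *)
Definition vf_coord (p : chart R n M) (X : forall x, tangent x)
    (y : 'rV[R]_n) : 'rV[R]_n :=
  let x := chart_inv p y in
  'd (p \o chart_inv (chart_at x)) (chart_at x x) (X x).

(* [X, Y] = DY X - DX Y in coordinates. *)
Definition vf_bracket (X Y : forall x, tangent x) (x : M) : tangent x :=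
  let p := chart_at x in
  'd (vf_coord p Y) (p x) (vf_coord p X (p x))
  - 'd (vf_coord p X) (p x) (vf_coord p Y (p x)).

End Manifolds.

HB.mixin Record isLieGroup (R : realType) (n : nat) G
    of SmoothManifold R n G & Group G := {
  lie_mul_continuous : continuous (fun z : G * G => (z.1 * z.2)%g);
  lie_mul_smooth : forall p : G,
    smooth_mfd2 [set z : G * G | chart_dom (chart_at p) (z.1 * z.2)%g]
      (fun x y => chart_at p (x * y)%g);
  lie_inv_continuous : continuous (fun x : G => (x^-1)%g);
  lie_inv_smooth : forall p : G,
    smooth_mfd [set x : G | chart_dom (chart_at p) (x^-1)%g]
      (fun x => chart_at p (x^-1)%g)
}.

#[short(type="lieGroupType")]
HB.structure Definition LieGroup (R : realType) (n : nat) :=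
  {G of isLieGroup R n G & SmoothManifold R n G & Group G}.

Section LieGroups.
Context {R : realType} {n : nat} (G : lieGroupType R n).

Definition lie_algebra := tangent (1%g : G).
HB.instance Definition _ := Vector.copy lie_algebra 'rV[R]_n.

Definition lie_dual := 'Hom(lie_algebra, R^o).

Definition left_translation (g h : G) : G := (g * h)%g.

(* T_e L_g lands in the tangent space at g * 1, i.e. at g. *)
Definition left_invariant_vf (xi : lie_algebra) (g : G) : tangent g :=
  tangent_map (left_translation g) 1%g xi.

Definition lie_bracket (xi eta : lie_algebra) : lie_algebra :=
  vf_bracket (left_invariant_vf xi) (left_invariant_vf eta) 1%g.

(* T*_e L_g, the dual of T_e L_g. *)
Definition cotangent_left (g : G) (alpha : cotangent g) : lie_dual :=
  linfun (fun eta : lie_algebra => alpha (left_invariant_vf eta g) : R^o).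

(* The right-hand side is linear in eta, as [linfun] requires, because the
   bracket of smooth vector fields is bilinear. *)
Definition ad_star (xi : lie_algebra) (mu : lie_dual) : lie_dual :=
  linfun (fun eta : lie_algebra => mu (lie_bracket xi eta) : R^o).

Section Decomposition.
Variables (m : nat) (e : n.-tuple lie_algebra).

Definition dual_basis : n.-tuple lie_dual :=
  [tuple linfun (coord e k : lie_algebra -> R^o) | k < n].

Definition r_space : {vspace lie_algebra} := <<take m e>>%VS.
Definition s_space : {vspace lie_algebra} := <<drop m e>>%VS.
Definition r_dual : {vspace lie_dual} := <<take m dual_basis>>%VS.
Definition s_dual : {vspace lie_dual} := <<drop m dual_basis>>%VS.

Definition r_part (alpha : lie_dual) : lie_dual :=
  daddv_pi r_dual s_dual alpha.
Definition s_part (alpha : lie_dual) : lie_dual :=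
  daddv_pi s_dual r_dual alpha.

Definition control (u : 'rV[R]_m) : lie_algebra :=
  \sum_(k < m) u 0 k *: e`_k.

Definition left_invariant_cost (C : G -> 'rV[R]_m -> R) : Prop :=
  forall (h g : G) (u : 'rV[R]_m), C (h * g)%g u = C g u.

(* dC/du at (g, u), an element of r* since C only depends on u^1, ..., u^m. *)
Definition cost_diff (C : G -> 'rV[R]_m -> R) (g : G) (u : 'rV[R]_m) :
    lie_dual :=
  \sum_(k < m) ('D_(delta_mx 0 k) (C g : 'rV[R]_m -> R^o) u : R)
                 *: dual_basis`_k.

End Decomposition.
End LieGroups.

(* Derivatives along a subset of the line; on [0, T] they are one-sided at
   the end points. *)

Section Curves.
Context {R : realType}.

Definition derivable_within (W : normedModType R) (A : set R) (f : R -> W)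
    (t : R) : Prop :=
  cvg ((fun s => (s - t)^-1 *: (f s - f t)) @ within A t^').

Definition derive_within (W : normedModType R) (A : set R) (f : R -> W)
    (t : R) : W :=
  lim ((fun s => (s - t)^-1 *: (f s - f t)) @ within A t^').

(* The derivative is read in every chart of the atlas. *)
Definition C1_curve (n : nat) (M : smoothManifoldType R n) (A : set R)
    (g : R -> M) : Prop :=
  {within A, continuous g} /\
  forall p : M,
    let Ap := A `&` g @^-1` chart_dom (chart_at p) in
    (forall t, Ap t -> derivable_within A (chart_at p \o g) t) /\
    {within Ap, continuous (derive_within A (chart_at p \o g))}.

Definition velocity (n : nat) (M : smoothManifoldType R n) (A : set R)
    (g : R -> M) (t : R) : tangent (g t) :=
  derive_within A (chart_at (g t) \o g) t.

(* As g* is finite-dimensional, curves in g* may be differentiated pointwise,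
   by evaluation on the elements of g. *)
Section DualCurves.
Context {n : nat} {G : lieGroupType R n}.

Definition dual_derivable (A : set R) (alpha : R -> lie_dual G) (t : R) :
    Prop :=
  forall eta : lie_algebra G,
    derivable_within A (fun s => alpha s eta : R^o) t.

Definition dual_derive (A : set R) (alpha : R -> lie_dual G) (t : R) :
    lie_dual G :=
  linfun (fun eta : lie_algebra G =>
            derive_within A (fun s => alpha s eta : R^o) t).

Definition dual_C1 (A : set R) (alpha : R -> lie_dual G) : Prop :=
  (forall t, A t -> dual_derivable A alpha t) /\
  (forall eta : lie_algebra G,
     {within A, continuous (fun t => dual_derive A alpha t eta : R)}).

End DualCurves.
End Curves.

Section Potentials.
Context {R : realType} {n : nat} {G : lieGroupType R n}.

Definition reduced_potential (V : G -> G -> R) (h : G) : R := V 1%g h.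

(* The partial derivative with respect to gi of V(e, gi^-1 gj). *)
Definition potential_diff (V : G -> G -> R) (gi gj : G) : cotangent gi :=
  mdiff (fun h : G => reduced_potential V (h^-1 * gj)%g) gi.

End Potentials.

Definition coupling (R : realType) (n : nat) (G : lieGroupType R n) (r : nat)
    (E : rel 'I_r) (V : 'I_r -> 'I_r -> G -> G -> R) (x : 'I_r -> G)
    (i : 'I_r) : lie_dual G :=
  \sum_(j < r | E i j) cotangent_left (potential_diff (V i j) (x i) (x j)).

(* Main.v *)
Require Import Defs.
From HB Require Import structures.
From mathcomp Require Import all_boot all_order all_algebra.
From mathcomp Require Import all_classical all_reals all_analysis.
Import Order.TTheory GRing.Theory Num.Theory.
Import numFieldNormedType.Exports.
Local Open Scope classical_set_scope.
Local Open Scope ring_scope.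

Set Implicit Arguments.
Unset Strict Implicit.

(* Decompose both sides along g* = r* + s*, that is, evaluate them on r and on s.
   Since dC/du takes values in r* and lambda in s*, so do their derivatives; and
   [r, r] <= s and [r, s] <= r make ad*_u (dC/du) vanish on r and ad*_u lambda
   vanish on s for u in r.
   This needs ad*_u mu to be <mu, [u, .]>, hence the linearity of the bracket of
   left-invariant vector fields.  In the coordinates of a chart p at the identity, the
   left-invariant field of xi is y |-> D_(0, xi) f (y, p(1)), where
   f(y, z) = p(p^-1(y) p^-1(z)) is smooth; it is therefore differentiable. *)

(** * Preliminaries from differential calculus and linear algebra *)

Lemma continuous_open_within (T U : topologicalType) (A : set T) (f : T -> U) x :
  open A -> {within A, continuous f} -> A x -> {for x, continuous f}.
Proof.
by move=> oA; rewrite continuous_open_subspace// => cf Ax; apply: cf; rewrite inE.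
Qed.

Section Calculus.
Context {K : numFieldType} {V W : normedModType K}.

(** The first-order remainders of [f] and [g] agree near [x], so [g] inherits the expansion of [f],
    and a continuous linear part of such an expansion is unique. *)
Lemma near_eq_is_diff (f g : V -> W) (x : V) :
  {near x, f =1 g} -> differentiable f x -> is_diff x g ('d f x).
Proof.
move=> fg df.
have gE : g \o shift x = cst (g x) + 'd f x +o_ 0 id.
  have /eqaddoP f0 := diff_locally df.
  apply/eqaddoP => eps eps0; have fgx := nbhs_singleton fg.
  have fg0 : \forall h \near 0, f (h + x) = g (h + x).
    by have := fg; rewrite (near_shift 0 x) /= subr0.
  near=> h.
  have -> : (g \o shift x - (cst (g x) + 'd f x)) h
          = (f \o shift x - (cst (f x) + 'd f x)) h.
    have E : f (h + x) = g (h + x) by near: h.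
    by rewrite /= -[LHS]/(g (h + x) - (g x + _)) -E -fgx.
  near: h; exact: f0.
have dg := diff_unique (diff_continuous df) gE.
apply: DiffDef; last exact: dg.
by apply/diff_locallyP; rewrite dg; split; first exact: diff_continuous.
Unshelve. all: by end_near. Qed.

Lemma diff_partial_right (U : normedModType K) (f : U * V -> W) a b :
  differentiable f (a, b) ->
  is_diff b (fun z => f (a, z)) (fun v => 'd f (a, b) (0, v)).
Proof.
move=> df; have dP : differentiable (fun z : V => (a, z)) b.
  exact: differentiable_pair.
apply: DiffDef; first exact: (differentiable_comp dP df).
have -> : (fun z => f (a, z)) = f \o (fun z : V => (a, z)) by [].
rewrite diff_comp//; apply/funext => v /=.
rewrite diff_pair//=; congr ('d f _ (_, _)); first by rewrite diff_cst.
by rewrite diff_val.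
Qed.

Lemma differentiable_partial_left (U : normedModType K) (f : V * U -> W) a b :
  differentiable f (a, b) -> differentiable (fun y => f (y, b)) a.
Proof.
by move=> df; apply: (@differentiable_comp _ _ _ _ (fun y => (y, b)) f).
Qed.

(** Linearity of the bracket in its second argument, in the coordinate form of [vf_bracket]. *)
Lemma diff_bracket_linear a (f g h : V -> V) x :
  differentiable g x -> differentiable h x ->
  let k y := a *: g y + h y in
  'd k x (f x) - 'd f x (k x) =
  a *: ('d g x (f x) - 'd f x (g x)) + ('d h x (f x) - 'd f x (h x)).
Proof.
move=> dg dh k; have -> : k = a *: g + h by [].
rewrite diffD; [|exact: differentiableZ|by []].
rewrite /= diffZ//= [in X in _ - X]linearP.
by rewrite scalerBr opprD addrACA.
Qed.

End Calculus.

(** [linfun] only records the values of [f] on a basis, so linearity has to be supplied before it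
    can be evaluated elsewhere. *)
Lemma lfun_linearE (K : fieldType) (aT rT : vectType K) (f : aT -> rT) :
  linear f -> linfun f =1 f.
Proof.
move=> lf; pose fM := GRing.isLinear.Build _ _ _ _ _ lf.
pose fL : {linear aT -> rT} := HB.pack f fM.
exact: (lfunE fL).
Qed.

(** The kernel of each generator in [X] is a subspace containing [Y], hence its span; every other
    [f] is a combination of generators. *)
Lemma span_annihilator (K : fieldType) (aT rT : vectType K)
    (X : seq 'Hom(aT, rT)) (Y : seq aT) :
  (forall f y, f \in X -> y \in Y -> f y = 0) ->
  forall f y, f \in <<X>>%VS -> y \in <<Y>>%VS -> f y = 0.
Proof.
move=> XY f y /= fX yY; rewrite (coord_span (X := in_tuple X) fX) sum_lfunE.
apply: big1 => i _; rewrite scale_lfunE.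
suff -> : X`_i y = 0 by rewrite scaler0.
have /span_subvP/subvP/(_ y yY) : {subset Y <= lker X`_i}.
  by move=> z zY; rewrite memv_ker; apply/eqP/XY => //; exact: mem_nth.
by rewrite memv_ker => /eqP.
Qed.

(** * Left-invariant vector fields and their bracket *)

Section LieBracket.
Context {R : realType} {n : nat} {G : lieGroupType R n}.
Implicit Types (x c : G) (xi eta : lie_algebra G).

(** For [c = 1] this is the function f of the opening comment; other [c] serve to differentiate left
    translations at arbitrary points. *)
Definition mul_coord c (z : 'rV[R]_n * 'rV[R]_n) : 'rV[R]_n :=
  chart_at c (chart_inv (chart_at c) z.1 *
              chart_inv (chart_at (1%g : G)) z.2)%g.

Lemma chart_at_invK x : chart_inv (chart_at x) (chart_at x x) = x.
Proof. exact/chart_funK/chart_at_dom. Qed.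

Lemma chart_inv_continuous_at x :
  {for chart_at x x, continuous (chart_inv (chart_at x))}.
Proof.
have := continuous_open_within (@chart_open_img _ _ _ (chart_at x))
  (@chart_inv_continuous _ _ _ (chart_at x)).
by apply; exists x => //; exact: chart_at_dom.
Qed.

Lemma mul_coord_smooth c x : chart_dom (chart_at c) x ->
  differentiable (mul_coord c) (chart_at c x, chart_at (1%g : G) 1%g) /\
  forall v, differentiable (fun z => 'D_v (mul_coord c) z)
    (chart_at c x, chart_at (1%g : G) 1%g).
Proof.
move=> cx; have Uz : [set (chart_at c z.1, chart_at (1%g : G) z.2) | z in
    (chart_dom (chart_at c) `*` chart_dom (chart_at (1%g : G))) `&`
    [set z : G * G | chart_dom (chart_at c) (z.1 * z.2)%g]]
    (chart_at c x, chart_at (1%g : G) 1%g).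
  exists (x, 1%g) => //; split; last by rewrite /= mulg1.
  by split => //; exact: chart_at_dom.
(* Order 2 of smoothness: one derivative produces the left-invariant field, the second makes this
   field differentiable. *)
have [d1 /(_ _) d2] := @lie_mul_smooth R n G c c 1%g 2.
by split=> [|v]; [exact: d1 | exact: (d2 v).1].
Qed.

Lemma left_translation_differentiable x :
  differentiable (chart_at x \o left_translation x \o
    chart_inv (chart_at (1%g : G))) (chart_at (1%g : G) 1%g).
Proof.
have [dm _] := mul_coord_smooth (chart_at_dom x).
have [+ _] := diff_partial_right dm.
by rewrite /mul_coord /= chart_at_invK.
Qed.

(** The tangent map lands at [x * 1]; all tangent spaces are the same row space, so only the chart
    at [x * 1] has to be replaced by the one at [x]. *)
Lemma left_invariant_vfE xi x : left_invariant_vf xi x =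
  'd (chart_at x \o left_translation x \o chart_inv (chart_at (1%g : G)))
    (chart_at (1%g : G) 1%g) xi.
Proof.
rewrite /left_invariant_vf /tangent_map lfunE.
by have -> : chart_at (left_translation x 1%g) = chart_at x
  by rewrite /left_translation mulg1.
Qed.

(** By the chain rule the left side is the differential at [z0] of [K \o L], the translation
    followed by the change of charts from [x] to [c]. Near [z0] this map is [mul_coord c] with its
    first coordinate frozen at [chart_at c x]. *)
Lemma vf_coord_left_invariant xi c x : chart_dom (chart_at c) x ->
  vf_coord (chart_at c) (left_invariant_vf xi) (chart_at c x) =
  'D_(0, xi) (mul_coord c) (chart_at c x, chart_at (1%g : G) 1%g).
Proof.
move=> cx; have [dm _] := mul_coord_smooth cx.
rewrite deriveE// /vf_coord chart_funK// left_invariant_vfE.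
set p := chart_at (1%g : G); set z0 := p 1%g.
set L := _ \o _ \o _; set K := _ \o _.
have Lz0 : L z0 = chart_at x x.
  by rewrite /L /= chart_at_invK /left_translation mulg1.
have dL : differentiable L z0 by exact: left_translation_differentiable.
have dK : differentiable K (L z0).
  rewrite Lz0; have [+ _] := @chart_at_compatible _ _ G x c 1%N; apply.
  by exists x => //; split => //; exact: chart_at_dom.
rewrite -Lz0 -[LHS]/(('d K (L z0) \o 'd L z0) xi) -diff_comp//.
have [_ /(congr1 (@^~ xi)) /= <-] := diff_partial_right dm.
have : is_diff z0 (fun z => mul_coord c (chart_at c x, z)) ('d (K \o L) z0).
  apply: near_eq_is_diff; last exact: differentiable_comp.
  (* By continuity, [x * chart_inv p z] stays in the domain of the chart at [x] for [z] near [z0];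
     there this chart cancels in [K \o L]. *)
  have cT : {for z0, continuous (left_translation x \o chart_inv p)}.
    apply: continuous_comp; first exact: chart_inv_continuous_at.
    rewrite chart_at_invK; apply: (@continuous_comp _ _ _ (fun h => (x, h))
      (fun z : G * G => (z.1 * z.2)%g)).
      by apply: cvg_pair => //; exact: cvg_cst.
    exact: lie_mul_continuous.
  have : nbhs ((left_translation x \o chart_inv p) z0) (chart_dom (chart_at x)).
    apply: open_nbhs_nbhs; split; first exact: chart_open_dom.
    by rewrite /= chart_at_invK /left_translation mulg1; exact: chart_at_dom.
  move=> /cT dx; near=> z.
  have dz : chart_dom (chart_at x) (x * chart_inv p z)%g by near: z; exact: dx.
  by rewrite /K /L /mul_coord /= !chart_funK.
case=> _ dE. exact: esym (congr1 (@^~ xi) dE).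
Unshelve. all: by end_near. Qed.

(** [vf_coord] uses a different chart at every point, which hides its regularity. The formula by
    [mul_coord] uses two fixed charts, is differentiable in y, and holds on the open image of the
    chart domain. *)
Lemma vf_coord_left_invariant_differentiable xi c :
  differentiable (vf_coord (chart_at c) (left_invariant_vf xi)) (chart_at c c).
Proof.
have cc := chart_at_dom c.
pose h y := 'D_(0, xi) (mul_coord c) (y, chart_at (1%g : G) 1%g).
suff nh : {near chart_at c c, h =1 vf_coord (chart_at c) (left_invariant_vf xi)}.
  have dh : differentiable h (chart_at c c).
    exact: differentiable_partial_left ((mul_coord_smooth cc).2 _).
  by case: (near_eq_is_diff nh dh).
have : nbhs (chart_at c c) (chart_at c @` chart_dom (chart_at c)).
  by apply: open_nbhs_nbhs; split; [exact: chart_open_img | exists c].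
by apply: filterS => _ [x cx <-]; rewrite /= vf_coord_left_invariant.
Qed.

Lemma left_invariant_vf_linear x a xi eta :
  left_invariant_vf (a *: xi + eta) x =
  a *: (left_invariant_vf xi x : 'rV[R]_n) + left_invariant_vf eta x.
Proof. by rewrite !left_invariant_vfE; exact: linearP. Qed.

(** In the chart at the identity the coordinates of a left-invariant field depend linearly on its
    generator and are differentiable, so [diff_bracket_linear] applies. *)
Lemma lie_bracket_linear xi : linear (lie_bracket xi).
Proof.
move=> a eta zeta; rewrite /lie_bracket /vf_bracket.
set p := chart_at _.
have d0 eta' := vf_coord_left_invariant_differentiable eta' (1%g : G).
have -> : vf_coord p (left_invariant_vf (a *: eta + zeta)) = fun y =>
    a *: vf_coord p (left_invariant_vf eta) y +
    vf_coord p (left_invariant_vf zeta) y.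
  apply/funext => y; rewrite /vf_coord left_invariant_vf_linear.
  exact: linearP.
exact: (diff_bracket_linear a _ (d0 eta) (d0 zeta)).
Qed.

Lemma lie_bracketC xi eta : lie_bracket xi eta = - lie_bracket eta xi.
Proof. by rewrite /lie_bracket /vf_bracket opprB. Qed.

Lemma ad_starE xi (mu : lie_dual G) eta :
  ad_star xi mu eta = mu (lie_bracket xi eta).
Proof.
rewrite /ad_star lfun_linearE// => a v w.
by rewrite lie_bracket_linear linearP.
Qed.

End LieBracket.

(** * The splitting of g* dual to that of g *)

Section Decomposition.
Context {R : realType} {n : nat} {G : lieGroupType R n}.
Variables (m : nat) (e : n.-tuple (lie_algebra G)).
Hypotheses (mn : (m <= n)%N) (basis_e : basis_of fullv e).
Implicit Types (alpha beta : lie_dual G) (xi : lie_algebra G).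

Lemma dual_basis_coord (i : 'I_n) xi : (dual_basis e)`_i xi = coord e i xi.
Proof.
by rewrite -(tnth_nth 0 (dual_basis e) i) tnth_mktuple lfunE.
Qed.

Lemma dual_basisE (i j : 'I_n) : (dual_basis e)`_i e`_j = (i == j)%:R.
Proof.
rewrite dual_basis_coord eq_sym.
exact: coord_free (basis_free basis_e).
Qed.

Lemma r_dual_annihilates_s alpha xi :
  alpha \in r_dual m e -> xi \in s_space m e -> alpha xi = 0.
Proof.
move: alpha xi; apply: span_annihilator => f y /(nthP 0)[i im <-] /(nthP 0)[j jn <-].
move: im jn; rewrite size_drop size_takel size_tuple// => im jn.
rewrite nth_take// nth_drop.
have i_n : (i < n)%N by exact: leq_trans mn.
have mj_n : (m + j < n)%N by rewrite -ltn_subRL.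
have := dual_basisE (Ordinal i_n) (Ordinal mj_n); rewrite /= => ->.
(* The two indices differ because i < m <= m + j. *)
by rewrite -val_eqE/= ltn_eqF // ltn_addr.
Qed.

Lemma s_dual_annihilates_r alpha xi :
  alpha \in s_dual m e -> xi \in r_space m e -> alpha xi = 0.
Proof.
move: alpha xi; apply: span_annihilator => f y /(nthP 0)[j jn <-] /(nthP 0)[i im <-].
move: jn im; rewrite size_drop size_takel size_tuple// => jn im.
rewrite nth_take// nth_drop.
have i_n : (i < n)%N by exact: leq_trans mn.
have mj_n : (m + j < n)%N by rewrite -ltn_subRL.
have := dual_basisE (Ordinal mj_n) (Ordinal i_n); rewrite /= => ->.
by rewrite -val_eqE/= gtn_eqF // ltn_addr.
Qed.

Lemma lie_dual_eqP alpha beta :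
  {in r_space m e, forall xi, alpha xi = beta xi} ->
  {in s_space m e, forall xi, alpha xi = beta xi} -> alpha = beta.
Proof.
move=> abr abs; apply/lfunP => xi.
have : xi \in (r_space m e + s_space m e)%VS.
  by rewrite -span_cat cat_take_drop (span_basis basis_e) memvf.
case/memv_addP => v vr [w ws ->]; rewrite !linearD.
by congr (_ + _); [exact: abr | exact: abs].
Qed.

Lemma r_s_dual_full : (r_dual m e + s_dual m e)%VS = fullv.
Proof.
rewrite -span_cat cat_take_drop; apply/eqP; rewrite eqEsubv subvf/=.
apply/subvP => alpha _.
(* The expansion of a form in the dual basis has its values on the basis as coefficients. *)
have -> : alpha = \sum_(k < n) (alpha e`_k : R) *: (dual_basis e)`_k.
  apply/lfunP => xi; rewrite sum_lfunE [in LHS](coord_basis basis_e (memvf xi)).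
  rewrite linear_sum; apply: eq_bigr => k _.
  rewrite linearZ scale_lfunE dual_basis_coord.
  exact: mulrC.
by apply: memv_suml => k _; apply/memvZ/memv_span/mem_nth; rewrite size_tuple.
Qed.

(** A form in both summands kills s and r, which together span g. *)
Lemma r_s_dual_disjoint : (r_dual m e :&: s_dual m e)%VS = 0%VS.
Proof.
apply/eqP; rewrite -subv0; apply/subvP => alpha; rewrite memv_cap memv0.
move=> /andP[ar as_]; apply/eqP/lie_dual_eqP => xi xiP; rewrite zero_lfunE.
  exact: s_dual_annihilates_r.
exact: r_dual_annihilates_s.
Qed.

Lemma r_s_partD alpha : r_part m e alpha + s_part m e alpha = alpha.
Proof.
by rewrite daddv_pi_add ?r_s_dual_disjoint// r_s_dual_full memvf.
Qed.

Lemma r_part_s alpha xi : xi \in s_space m e -> r_part m e alpha xi = 0.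
Proof. by move=> ?; apply: r_dual_annihilates_s => //; exact: memv_pi. Qed.

Lemma s_part_r alpha xi : xi \in r_space m e -> s_part m e alpha xi = 0.
Proof. by move=> ?; apply: s_dual_annihilates_r => //; exact: memv_pi. Qed.

Lemma r_part_r alpha xi : xi \in r_space m e -> r_part m e alpha xi = alpha xi.
Proof.
by move=> xr; rewrite -[in RHS](r_s_partD alpha) add_lfunE s_part_r// addr0.
Qed.

Lemma s_part_s alpha xi : xi \in s_space m e -> s_part m e alpha xi = alpha xi.
Proof.
by move=> xs; rewrite -[in RHS](r_s_partD alpha) add_lfunE r_part_s// add0r.
Qed.

Lemma control_r_space (u : 'rV[R]_m) : control e u \in r_space m e.
Proof.
apply: memv_suml => k _; apply/memvZ/memv_span.
rewrite -(nth_take 0 (ltn_ord k)); apply: mem_nth.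
by rewrite size_takel// size_tuple.
Qed.

Lemma cost_diff_r_dual (C : G -> 'rV[R]_m -> R) g u :
  cost_diff e C g u \in r_dual m e.
Proof.
apply: memv_suml => k _; apply/memvZ/memv_span.
rewrite -(nth_take 0 (ltn_ord k)); apply: mem_nth.
by rewrite size_takel// size_tuple.
Qed.

End Decomposition.

(** * Derivatives along [0, T] of curves in g* *)

Lemma within_itv_dnbhs_proper (R : realType) (T t : R) :
  0 < T -> 0 <= t <= T -> ProperFilter (within [set s | 0 <= s <= T] t^').
Proof.
move=> T0 /andP[t0 tT]; apply: Build_ProperFilter_ex => P HP.
have {}HP : \forall s \near t, s != t -> 0 <= s <= T -> P s by [].
(* The point [t] is approached inside the interval from the right if t < T, and from the left if t =
   T, where 0 < T leaves room. *)
have [tT'|Tt] := ltP t T.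
- near (at_right t) => s; exists s.
  have ts : t < s by near: s; exact: nbhs_right_gt.
  suff : s != t -> 0 <= s <= T -> P s.
    apply; first by rewrite gt_eqF.
    rewrite (le_trans t0 (ltW ts))/=; apply/ltW.
    by near: s; exact: nbhs_right_lt.
  by near: s; exact: cvg_within.
- have t_gt0 : 0 < t by exact: lt_le_trans Tt.
  near (at_left t) => s; exists s.
  have st : s < t by near: s; exact: nbhs_left_lt.
  suff : s != t -> 0 <= s <= T -> P s.
    apply; first by rewrite lt_eqF.
    rewrite (ltW (lt_le_trans st tT)) andbT; apply/ltW.
    by near: s; exact: nbhs_left_gt.
  by near: s; exact: cvg_within.
Unshelve. all: by end_near. Qed.

Section DualDerivative.
Context {R : realType} {n : nat} {G : lieGroupType R n}.
Variables (A : set R) (t : R).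
(** Properness says that [t] is an accumulation point of [A]; it makes limits of difference
    quotients unique. *)
Hypothesis At : ProperFilter (within A t^').
Implicit Types (alpha beta : R -> lie_dual G) (eta : lie_algebra G).

(** Stated as a convergence, it yields both the existence of the derivative and its value. *)
Lemma derive_within_linear (W : normedModType R) a (f g : R -> W) :
  derivable_within A f t -> derivable_within A g t ->
  (fun s => (s - t)^-1 *: ((a *: f s + g s) - (a *: f t + g t)))
    @ within A t^' --> a *: derive_within A f t + derive_within A g t.
Proof.
move=> df dg.
have -> : (fun s => (s - t)^-1 *: ((a *: f s + g s) - (a *: f t + g t))) =
   (fun s => a *: ((s - t)^-1 *: (f s - f t)) + (s - t)^-1 *: (g s - g t)).
  apply/funext => s; rewrite opprD addrACA -scalerBr scalerDr !scalerA.
  by rewrite [a * _]mulrC.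
apply: cvgD; last exact: dg.
by apply: cvgZ; [exact: cvg_cst | exact: df].
Qed.

(** The derivative of the evaluation at [eta] is linear in [eta] by uniqueness of limits, so
    [linfun] leaves it unchanged. *)
Lemma dual_deriveE alpha eta : dual_derivable A alpha t ->
  dual_derive A alpha t eta = derive_within A (fun s => alpha s eta : R^o) t.
Proof.
move=> da; rewrite /dual_derive lfun_linearE// => a v w.
rewrite [LHS]/derive_within.
have -> : (fun s => (s - t)^-1 *:
      ((alpha s (a *: v + w) : R^o) - alpha t (a *: v + w))) =
    (fun s => (s - t)^-1 *: ((a *: (alpha s v : R^o) + alpha s w) -
                             (a *: (alpha t v : R^o) + alpha t w))).
  by apply/funext => s; rewrite !linearP.
by apply: cvg_lim => //; exact: derive_within_linear (da v) (da w).
Qed.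

Lemma dual_deriveD alpha beta :
  dual_derivable A alpha t -> dual_derivable A beta t ->
  dual_derive A (fun s => alpha s + beta s) t =
  dual_derive A alpha t + dual_derive A beta t.
Proof.
move=> da db.
have ab eta : (fun s => (s - t)^-1 *:
      ((alpha s + beta s) eta - (alpha t + beta t) eta : R^o)) @ within A t^' -->
    (derive_within A (fun s => alpha s eta : R^o) t +
     derive_within A (fun s => beta s eta : R^o) t).
  have -> : (fun s => (s - t)^-1 *:
      ((alpha s + beta s) eta - (alpha t + beta t) eta : R^o)) =
    (fun s => (s - t)^-1 *: ((1 *: (alpha s eta : R^o) + beta s eta) -
                             (1 *: (alpha t eta : R^o) + beta t eta))).
    by apply/funext => s; rewrite !add_lfunE !scale1r.
  rewrite -[X in _ --> X + _]scale1r.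
  exact: derive_within_linear (da eta) (db eta).
have dab : dual_derivable A (fun s => alpha s + beta s) t.
  by move=> eta; apply/cvg_ex; eexists; exact: (ab eta).
apply/lfunP => eta; rewrite add_lfunE (dual_deriveE _ dab).
rewrite (dual_deriveE _ da) (dual_deriveE _ db).
exact: cvg_lim (ab eta).
Qed.

Lemma dual_derive_annihilates alpha eta : A t -> dual_derivable A alpha t ->
  (forall s, A s -> alpha s eta = 0) -> dual_derive A alpha t eta = 0.
Proof.
move=> tA da a0; rewrite dual_deriveE//; apply: cvg_lim => //.
apply: cvg_near_cst; apply: filterS (withinT A (dnbhs_filter t)) => s sA.
by rewrite !a0// subrr scaler0.
Qed.

End DualDerivative.

(** * Splitting the equation along r* and s* *)

Theorem proposition4p2 (R : realType) (n m : nat) (G : lieGroupType R n)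
  (e : n.-tuple (lie_algebra G)) (T : R)
  (r : nat) (E : rel 'I_r)
  (g : 'I_r -> R -> G) (u : 'I_r -> R -> 'rV[R]_m)
  (lambda : 'I_r -> R -> lie_dual G)
  (C : 'I_r -> G -> 'rV[R]_m -> R)
  (V : 'I_r -> 'I_r -> G -> G -> R) :
  let I := [set t : R | 0 <= t <= T] in
  let ui := fun (i : 'I_r) (t : R) => control e (u i t) in
  let dC := fun (i : 'I_r) (t : R) => cost_diff e (C i) (g i t) (u i t) in
  let F := fun (i : 'I_r) (t : R) => coupling E V (g^~ t) i in
  0 < T ->
  (m <= n)%N ->
  basis_of fullv e ->
  (forall xi eta, xi \in s_space m e -> eta \in s_space m e ->
     lie_bracket xi eta \in s_space m e) ->
  (forall xi eta, xi \in s_space m e -> eta \in r_space m e ->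
     lie_bracket xi eta \in r_space m e) ->
  (forall xi eta, xi \in r_space m e -> eta \in r_space m e ->
     lie_bracket xi eta \in s_space m e) ->
  symmetric E ->
  (forall i j, connect E i j) ->
  (forall i, C1_curve I (g i)) ->
  (forall i t, I t -> velocity I (g i) t = left_invariant_vf (ui i t) (g i t)) ->
  (forall i, dual_C1 I (lambda i)) ->
  (forall i t, I t -> lambda i t \in s_dual m e) ->
  (forall i, smooth_mfd_vec (C i : G -> 'rV[R]_m -> R^o)) ->
  (forall i, left_invariant_cost (C i)) ->
  (forall i t, I t -> dual_derivable I (dC i) t) ->
  (forall i j, E i j ->
     smooth_mfd2 [set: G * G] (V i j : G -> G -> R^o)) ->
  forall (i : 'I_r) (t : R), I t ->
    (0 = dual_derive I (fun s => dC i s + lambda i s) t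
         - ad_star (ui i t) (dC i t + lambda i t)
         - F i t)
    <->
    (dual_derive I (dC i) t
       = r_part m e (ad_star (ui i t) (lambda i t)) + r_part m e (F i t)
     /\
     dual_derive I (lambda i) t
       = s_part m e (ad_star (ui i t) (dC i t)) + s_part m e (F i t)).
Proof.
move=> I ui dC F T0 mn basis_e ss sr rr _ _ _ _ lC1 ls _ _ dCd _ i t It.
have properI : ProperFilter (within I t^') by exact: within_itv_dnbhs_proper.
have ld : dual_derivable I (lambda i) t by exact: (lC1 i).1.
have dd := dCd i t It.
have ur : ui i t \in r_space m e by exact: control_r_space.
have dCr s : dC i s \in r_dual m e by exact: cost_diff_r_dual.
have dC's xi : xi \in s_space m e -> dual_derive I (dC i) t xi = 0.
  move=> xs; apply: dual_derive_annihilates => // s _.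
  exact: r_dual_annihilates_s xs.
have l'r xi : xi \in r_space m e -> dual_derive I (lambda i) t xi = 0.
  move=> xr; apply: dual_derive_annihilates => // s sI.
  exact: s_dual_annihilates_r (ls i s sI) xr.
have adr xi : xi \in r_space m e -> ad_star (ui i t) (dC i t) xi = 0.
  move=> xr; rewrite ad_starE.
  by apply: (r_dual_annihilates_s mn basis_e) => //; exact: rr.
have ads xi : xi \in s_space m e -> ad_star (ui i t) (lambda i t) xi = 0.
  (* Antisymmetry turns [u, xi] into -[xi, u], which lies in r by the inclusion of [s, r] in r. *)
  move=> xs; rewrite ad_starE lie_bracketC.
  apply: (s_dual_annihilates_r mn basis_e); first exact: ls.
  by rewrite rpredN; exact: sr.
have adD : ad_star (ui i t) (dC i t + lambda i t) =
    ad_star (ui i t) (dC i t) + ad_star (ui i t) (lambda i t).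
  by apply/lfunP => xi; rewrite add_lfunE !ad_starE add_lfunE.
rewrite dual_deriveD// adD.
set a := dual_derive I (dC i) t in dC's *.
set b := dual_derive I (lambda i) t in l'r *.
set p := ad_star _ (dC i t) in adr *; set q := ad_star _ (lambda i t) in ads *.
apply: (@iff_trans _ (a + b = p + q + F i t)).
  split=> [/eqP|->]; last by rewrite addrAC addrK subrr.
  by rewrite eq_sym -addrA -opprD subr_eq0 => /eqP.
(* On r the terms [b] and [p] vanish, leaving a = q + F; on s the terms [a] and [q] vanish, leaving
   b = p + F. Each of the two target equations is trivial on the other summand, where both of its
   sides are zero. *)
split=> [abE|[-> ->]].
- have abxi xi : a xi + b xi = p xi + q xi + F i t xi by rewrite -!add_lfunE abE.
  split; apply: (lie_dual_eqP (m := m) basis_e) => xi xiP; rewrite add_lfunE.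
  + rewrite !r_part_r//.
    by have := abxi xi; rewrite (l'r _ xiP) (adr _ xiP) addr0 add0r.
  + by rewrite !r_part_s// addr0 dC's.
  + by rewrite !s_part_r// addr0 l'r.
  + rewrite !s_part_s//.
    by have := abxi xi; rewrite (dC's _ xiP) (ads _ xiP) addr0 add0r.
(* Conversely, on each summand one projection is the identity, the other is zero, and one of [p] and
   [q] drops out. *)
- apply: (lie_dual_eqP (m := m) basis_e) => xi xiP; rewrite !add_lfunE.
  + rewrite !(r_part_r mn basis_e _ xiP) !(s_part_r mn basis_e _ xiP).
    by rewrite !addr0 (adr _ xiP) add0r.
  + rewrite !(r_part_s mn basis_e _ xiP) !(s_part_s mn basis_e _ xiP).
    by rewrite !add0r (ads _ xiP) addr0.
Qed.
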